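(* Let $Q=\{Q_0(x),\dots,Q_{n-1}(x)\}$, $\deg Q_k=k$, be a system of quasiseparable polynomials satisfying $$\begin{bmatrix}G_k(x)\\Q_k(x)\end{bmatrix}=\begin{bmatrix}\alpha_k&\beta_k\\ \gamma_k&\delta_kx+\theta_k\end{bmatrix}\begin{bmatrix}G_{k-1}(x)\\Q_{k-1}(x)\end{bmatrix},\qquad k=1,\dots,n-1 .$$ Then the following recurrence relations hold for the columns $\mathbf{s}_k$ of $S_{PQ}$ and $\mathbf{t}_k$ of $S_{PG}$, for all $k=1,\dots,n-1$: $$\mathbf{t}_{k+1}=\alpha_k\mathbf{t}_k+\beta_k\mathbf{s}_k,\qquad\mathbf{s}_{k+1}=\gamma_k\mathbf{t}_k+(\delta_kZ_0+\theta_kI)\mathbf{s}_k,$$ where $Z_0$ is the $n\times n$ lower shift matrix. As a consequence, all entries of $S_{PQ}$ can be computed in $\mathcal{O}(n^2)$ operations.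
   Context: $S_{PQ}$ is the $n\times n$ basis transformation matrix from $Q$ to the monomial basis $P=\{1,x,\dots,x^{n-1}\}$: its $j$-th column $\mathbf{s}_j$ contains the coefficients of $Q_{j-1}$, i.e. $Q_{j-1}(x)=\sum_{i=1}^n[S_{PQ}]_{ij}x^{i-1}$. Similarly $S_{PG}$ is the $n\times n$ matrix whose $j$-th column $\mathbf{t}_j$ contains the coefficients of the auxiliary polynomial $G_{j-1}$, $j=1,\dots,n$ (the $G_k$ have degree at most $n-1$). $Z_0$ has ones on the first subdiagonal and zeros elsewhere. Operations are arithmetic operations over $\mathbb{C}$; the recurrence coefficients and $Q_0,G_0$ are given. *)

(* Defs.v *)
From mathcomp Require Import all_boot all_order all_algebra.
From mathcomp Require Import complex reals.

Set Implicit Arguments.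
Unset Strict Implicit.
Unset Printing Implicit Defensive.

Import GRing.Theory.
Local Open Scope ring_scope.

Section Systems.
Variable F : fieldType.

(* Only the values at the indices 1, ..., n-1 are used. *)
Record recurrence_coefs := RecurrenceCoefs {
  alpha : nat -> F;
  beta : nat -> F;
  gamma : nat -> F;
  delta : nat -> F;
  theta : nat -> F
}.

Definition quasiseparable_system (n : nat) (r : recurrence_coefs)
    (G Q : nat -> {poly F}) : Prop :=
  [/\ forall k, (k < n)%N -> size (Q k) = k.+1,
      forall k, (k < n)%N -> (size (G k) <= n)%N
    & forall k, (0 < k < n)%N ->
        G k = alpha r k *: G k.-1 + beta r k *: Q k.-1 /\
        Q k = gamma r k *: G k.-1
              + (delta r k *: 'X + (theta r k)%:P) * Q k.-1].

(* For P = Q this is S_PQ, for P = G it is S_PG; rows and columns are numbered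
   from 0, so that column j holds the coefficients of P_j. *)
Definition basis_mx (n : nat) (P : nat -> {poly F}) : 'M[F]_n :=
  \matrix_(i < n, j < n) (P j)`_i.

Definition lower_shift (n : nat) : 'M[F]_n :=
  \matrix_(i < n, j < n) (i == j.+1 :> nat)%:R.

End Systems.

(* Straight-line programs: an instruction applies an arithmetic operation to
   the contents of two memory cells and appends the result to the memory. The
   program does not depend on the data, and its cost is its length. *)
Inductive arith_op := Add | Sub | Mul | Div.

Record instruction := Instruction {
  operation : arith_op;
  left_addr : nat;
  right_addr : nat
}.

Definition slp := seq instruction.

Section Execution.
Variable F : fieldType.

Definition apply_op (o : arith_op) (x y : F) : option F :=
  match o with
  | Add => Some (x + y)
  | Sub => Some (x - y)
  | Mul => Some (x * y)
  | Div => if y == 0 then None else Some (x / y)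
  end.

Definition exec_instruction (ins : instruction) (mem : seq F) :
    option (seq F) :=
  match onth mem (left_addr ins), onth mem (right_addr ins) with
  | Some x, Some y => omap (rcons mem) (apply_op (operation ins) x y)
  | _, _ => None
  end.

(* [None] means that an address was invalid or a divisor was zero. *)
Fixpoint exec (p : slp) (mem : seq F) : option (seq F) :=
  if p is ins :: p' then obind (exec p') (exec_instruction ins mem)
  else Some mem.

Definition input_data (n : nat) (r : recurrence_coefs F)
    (Q0 G0 : {poly F}) : seq F :=
  [seq alpha r k | k <- iota 1 n.-1] ++ [seq beta r k | k <- iota 1 n.-1] ++
  [seq gamma r k | k <- iota 1 n.-1] ++ [seq delta r k | k <- iota 1 n.-1] ++
  [seq theta r k | k <- iota 1 n.-1] ++
  [seq Q0`_i | i <- iota 0 n] ++ [seq G0`_i | i <- iota 0 n].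

(* Run on [input], [p] succeeds and leaves the entry A i j at address
   [out i j]. *)
Definition computes_mx (p : slp) (input : seq F) (n : nat)
    (out : 'I_n -> 'I_n -> nat) (A : 'M[F]_n) : Prop :=
  exists2 mem, exec p input = Some mem
    & forall i j, onth mem (out i j) = Some (A i j).

End Execution.

(* Main.v *)
Require Import Defs.
From mathcomp Require Import all_boot all_order all_algebra.
From mathcomp Require Import complex reals.

(** The column recurrences are the polynomial recurrences read coefficient by
    coefficient: multiplication by x moves the coefficient of x^(i-1) to x^i,
    which is the action of the lower shift on coefficient columns
    ([lower_shift_mulE]), and no coefficient is lost at the bottom because
    only rows below n are read.

    For the operation count, the recurrence gives each entry of the columns
    t_(k+1) and s_(k+1) from entries of t_k and s_k by at most 3 and 5
    operations. There are at most n columns of n entries in each of the two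
    matrices, so 8n^2 operations are enough ([basis_computable]).

    To turn this into a single program that serves all data, a value is
    regarded as a function of the data, and it is available after a program
    when some address, the same for all data, holds it ([available]). An
    instruction only appends a cell, so it keeps everything that was
    available ([append_op]), and no explicit memory layout is needed beyond
    the input. The addresses of the n^2 outputs are picked at the end, by
    choice over the finite set of index pairs. *)

Set Implicit Arguments.
Unset Strict Implicit.
Unset Printing Implicit Defensive.

Import GRing.Theory.
Local Open Scope ring_scope.

(** * Recurrences for the coefficient columns *)

Section Columns.
Variable F : fieldType.

(** The function f extends the entries of v to all of nat, so that i.-1 can be
    written without a proof that it is an index. *)
Lemma lower_shift_mulE n (v : 'cV[F]_n) (i : 'I_n) (f : nat -> F) :
  (forall j : 'I_n, v j 0 = f j) ->
  (lower_shift F n *m v) i 0 = if i == 0%N :> nat then 0 else f i.-1.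
Proof.
move=> vE; rewrite mxE.
under eq_bigr => j _ do rewrite mxE vE mulr_natl mulrb.
case: i => -[|i] lt_in /=; first by rewrite big1.
rewrite (bigD1 (Ordinal (ltnW lt_in))) //= eqxx big1 ?addr0 // => j ne_ji.
by rewrite ifN // eqSS eq_sym.
Qed.

Variables (n : nat) (r : recurrence_coefs F) (G Q : nat -> {poly F}).
Hypothesis sysGQ : quasiseparable_system n r G Q.

Lemma coef_G_rec k i : (k.+1 < n)%N ->
  (G k.+1)`_i = alpha r k.+1 * (G k)`_i + beta r k.+1 * (Q k)`_i.
Proof.
by case: sysGQ => _ _ /(_ k.+1) recGQ /recGQ[-> _]; rewrite coefD !coefZ.
Qed.

Lemma coef_Q_rec k i : (k.+1 < n)%N ->
  (Q k.+1)`_i = gamma r k.+1 * (G k)`_i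
    + (delta r k.+1 * (if i == 0%N then 0 else (Q k)`_i.-1)
       + theta r k.+1 * (Q k)`_i).
Proof.
case: sysGQ => _ _ /(_ k.+1) recGQ /recGQ[_ ->].
by rewrite mulrDl -scalerAl mul_polyC !coefD !coefZ coefXM.
Qed.

Lemma col_G_rec k (lt_kn : (k < n)%N) (lt_k1n : (k.+1 < n)%N) :
  col (Ordinal lt_k1n) (basis_mx n G) =
    alpha r k.+1 *: col (Ordinal lt_kn) (basis_mx n G)
    + beta r k.+1 *: col (Ordinal lt_kn) (basis_mx n Q).
Proof. by apply/colP=> i; rewrite !mxE coef_G_rec. Qed.

Lemma col_Q_rec k (lt_kn : (k < n)%N) (lt_k1n : (k.+1 < n)%N) :
  col (Ordinal lt_k1n) (basis_mx n Q) =
    gamma r k.+1 *: col (Ordinal lt_kn) (basis_mx n G)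
    + (delta r k.+1 *: lower_shift F n + (theta r k.+1)%:M)
      *m col (Ordinal lt_kn) (basis_mx n Q).
Proof.
apply/colP=> i; rewrite mulmxDl -scalemxAl mul_scalar_mx.
rewrite [LHS]mxE [LHS]mxE coef_Q_rec //.
set q := col (Ordinal lt_kn) (basis_mx n Q).
have ZqE : (lower_shift F n *m q) i 0 =
    if i == 0%N :> nat then 0 else (Q k)`_i.-1.
  by apply: (@lower_shift_mulE _ q i (nth 0 (Q k))) => j; rewrite !mxE.
by move: (_ *m q) ZqE => Zq ZqE; rewrite !mxE ZqE.
Qed.

End Columns.

(** * Values available to a straight-line program *)

Section Availability.
Variables (F : fieldType) (D : Type) (input : D -> seq F).

Lemma exec_rcons p ins (mem : seq F) :
  exec (rcons p ins) mem = obind (exec_instruction ins) (exec p mem).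
Proof.
elim: p mem => [|ins' p IHp] mem /=; first by case: exec_instruction.
by case: (exec_instruction ins' mem) => //=.
Qed.

Lemma size_exec p (mem mem' : seq F) :
  exec p mem = Some mem' -> size mem' = (size mem + size p)%N.
Proof.
elim: p mem => [|ins p IHp] mem /=; first by case=> <-; rewrite addn0.
rewrite /exec_instruction.
case: (onth mem _) => // x; case: (onth mem _) => // y.
by case: apply_op => //= z /IHp->; rewrite size_rcons addnS.
Qed.

Lemma onth_rcons_some (mem : seq F) a x y :
  onth mem a = Some x -> onth (rcons mem y) a = Some x.
Proof. by elim: mem a => [|z mem IH] [|a] //=; apply: IH. Qed.

Lemma onth_rcons_size (mem : seq F) y : onth (rcons mem y) (size mem) = Some y.
Proof. by elim: mem. Qed.

(** The address is chosen before the data: programs must be oblivious. *)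
Definition available (p : slp) (v : D -> F) : Prop :=
  exists a, forall d, exists2 mem,
    exec p (input d) = Some mem & onth mem a = Some (v d).

Definition preserves (p p' : slp) : Prop :=
  forall v, available p v -> available p' v.

(** Quantifying over all later programs [p1] lets costs add up: the second of
    two values can be computed after the instructions spent on the first. *)
Definition computable_within (c : nat) (p : slp) (v : D -> F) : Prop :=
  forall p1, preserves p p1 ->
  exists p2, [/\ preserves p1 p2, (size p2 <= size p1 + c)%N & available p2 v].

Lemma eq_within c p v w :
  v =1 w -> computable_within c p v -> computable_within c p w.
Proof.
move=> eq_vw cv p1 /cv[p2 [pp2 le_c [a va]]]; exists p2; split=> //.
by exists a => d; rewrite -eq_vw.
Qed.

Lemma within_leq c c' p v :
  (c <= c')%N -> computable_within c p v -> computable_within c' p v.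
Proof.
move=> le_cc' cv p1 /cv[p2 [pp2 le_c av]]; exists p2; split=> //.
by apply: leq_trans le_c _; rewrite leq_add2l.
Qed.

Lemma within_preserves c p p' v :
  preserves p p' -> computable_within c p v -> computable_within c p' v.
Proof. by move=> pp' cv p1 p'p1; apply: cv => w /pp'/p'p1. Qed.

Lemma available_within p v : available p v -> computable_within 0 p v.
Proof. by move=> av p1 pp1; exists p1; rewrite addn0; split; [|..|exact: pp1]. Qed.

(** Each value is computed after the previous ones, and [preserves] keeps the
    previous ones available until the end. *)
Lemma within_all c p m (w : nat -> D -> F) :
  (forall i, (i < m)%N -> computable_within c p (w i)) ->
  exists p', [/\ preserves p p', (size p' <= size p + m * c)%N
               & forall i, (i < m)%N -> available p' (w i)].
Proof.
elim: m => [|m IHm] cw; first by exists p; rewrite addn0; split.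
have [i lt_im|p1 [pp1 le_p1 aw]] := IHm; first exact/cw/ltnW.
have [p2 [p1p2 le_p2 awm]] := cw m (ltnSn m) p1 pp1.
exists p2; split=> [v /pp1/p1p2 //||i].
  by apply: leq_trans le_p2 _; rewrite mulSn addnCA addnC leq_add2l.
by rewrite ltnS leq_eqVlt => /predU1P[->//|/aw/p1p2].
Qed.

Variable N : nat.
Hypothesis size_input : forall d, size (input d) = N.

(** The new value sits at address N + size p for all data, since every
    instruction appends exactly one cell. *)
Lemma append_op o p x y z :
  available p x -> available p y ->
  (forall d, apply_op o (x d) (y d) = Some (z d)) ->
  exists p', [/\ preserves p p', size p' = (size p).+1 & available p' z].
Proof.
move=> [a xa] [b yb] zE.
have exec_z d : exists2 mem, exec p (input d) = Some mem
    & exec (rcons p (Instruction o a b)) (input d) = Some (rcons mem (z d)).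
  have [mem pE memx] := xa d; have [mem' + memy] := yb d.
  rewrite pE => -[eq_mem]; rewrite -eq_mem in memy.
  exists mem => //.
  by rewrite exec_rcons pE /= /exec_instruction /= memx memy /= zE.
exists (rcons p (Instruction o a b)); split; last 1 first.
- exists (N + size p)%N => d; have [mem pE p'E] := exec_z d.
  exists (rcons mem (z d)) => //.
  by rewrite -(size_input d) -(size_exec pE) onth_rcons_size.
- move=> v [e ve]; exists e => d; have [mem pE p'E] := exec_z d.
  exists (rcons mem (z d)) => //; apply: onth_rcons_some.
  by have [mem' +] := ve d; rewrite pE => -[<-].
- by rewrite size_rcons.
Qed.

Lemma within_op o c1 c2 p x y z :
  computable_within c1 p x -> computable_within c2 p y ->
  (forall d, apply_op o (x d) (y d) = Some (z d)) ->
  computable_within (c1 + c2).+1 p z.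
Proof.
move=> cx cy zE p1 pp1.
have [p2 [p1p2 le_p2 ax]] := cx _ pp1.
have [p3 [p2p3 le_p3 ay]] := cy _ (fun v av => p1p2 v (pp1 v av)).
have [p4 [p3p4 p4E az]] := append_op (p2p3 _ ax) ay zE.
exists p4; split=> // [v av|]; first exact/p3p4/p2p3/p1p2.
rewrite p4E addnS ltnS addnA; apply: leq_trans le_p3 _.
by rewrite leq_add2r.
Qed.

Lemma within_add c1 c2 p x y :
  computable_within c1 p x -> computable_within c2 p y ->
  computable_within (c1 + c2).+1 p (fun d => x d + y d).
Proof. by move=> cx cy; apply: (@within_op Add _ _ _ x y). Qed.

Lemma within_mul p x y :
  available p x -> available p y ->
  computable_within 1 p (fun d => x d * y d).
Proof.
move=> /available_within cx /available_within cy.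
exact: (@within_op Mul 0 0 _ x y).
Qed.

Lemma available_input (pre post : D -> seq F) (f : D -> nat -> F) a m b k :
  (forall d, input d = pre d ++ [seq f d i | i <- iota a m] ++ post d) ->
  (forall d, size (pre d) = b) -> (a <= k < a + m)%N ->
  available [::] (fun d => f d k).
Proof.
move=> inputE size_pre /andP[le_ak lt_k]; exists (b + (k - a))%N => d.
exists (input d) => //; rewrite inputE -(size_pre d).
elim: (pre d) => [|x s IHs] //=; rewrite add0n.
elim: m a le_ak lt_k {inputE} => [|m IHm] a le_ak.
  by rewrite addn0 ltnNge le_ak.
rewrite addnS -addSn => lt_k; move: le_ak; rewrite leq_eqVlt.
case/predU1P=> [->|lt_ak]; first by rewrite subnn.
by rewrite -(subnSK lt_ak); apply: IHm.
Qed.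

End Availability.

(** * Computing the basis transformation matrix *)

Section Computation.
Variables (F : fieldType) (n : nat).

(** Packing the hypothesis with the data makes the systems alone the type D of
    data for which values are available. *)
Record system := System {
  coefs : recurrence_coefs F;
  auxP : nat -> {poly F};
  mainP : nat -> {poly F};
  systemP : quasiseparable_system n coefs auxP mainP
}.

Let input (d : system) := input_data n (coefs d) (mainP d 0) (auxP d 0).
Let avail := available input.

Lemma size_input_data d : size (input d) = (5 * n.-1 + 2 * n)%N.
Proof.
rewrite /input /input_data !size_cat !size_map !size_iota.
by rewrite !mulSn mul0n !addn0 !addnA.
Qed.

Lemma coefs_available k : (0 < k < n)%N ->
  [/\ avail [::] (fun d => alpha (coefs d) k),
      avail [::] (fun d => beta (coefs d) k),
      avail [::] (fun d => gamma (coefs d) k),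
      avail [::] (fun d => delta (coefs d) k)
    & avail [::] (fun d => theta (coefs d) k)].
Proof.
move=> kn; pose seg (f : recurrence_coefs F -> nat -> F) d :=
  [seq f (coefs d) i | i <- iota 1 n.-1].
have size_seg f d : size (seg f d) = n.-1 by rewrite size_map size_iota.
have k1n : (1 <= k < 1 + n.-1)%N.
  by case/andP: kn => k0 kn; rewrite k0 add1n prednK // (leq_ltn_trans _ kn).
have avail_seg pre post f b :
    (forall d, input d = pre d ++ [seq f d j | j <- iota 1 n.-1] ++ post d) ->
    (forall d, size (pre d) = b) -> avail [::] (fun d => f d k).
  by move=> inputE size_pre; apply: available_input inputE size_pre k1n.
split.
- by eapply (avail_seg (fun=> [::])).
- by eapply (avail_seg (seg (@alpha F))).
- eapply (avail_seg (fun d => seg (@alpha F) d ++ seg (@beta F) d)) => d.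
    by rewrite -!catA.
  by rewrite size_cat !size_seg.
- eapply (avail_seg (fun d => seg (@alpha F) d ++ seg (@beta F) d ++
                              seg (@gamma F) d)) => d.
    by rewrite -!catA.
  by rewrite !size_cat !size_seg.
- eapply (avail_seg (fun d => seg (@alpha F) d ++ seg (@beta F) d ++
                              seg (@gamma F) d ++ seg (@delta F) d)) => d.
    by rewrite -!catA.
  by rewrite !size_cat !size_seg.
Qed.

Lemma initial_available i : (i < n)%N ->
  avail [::] (fun d => (mainP d 0)`_i) /\ avail [::] (fun d => (auxP d 0)`_i).
Proof.
move=> lt_in; pose coefs_part d :=
  [seq alpha (coefs d) k | k <- iota 1 n.-1] ++
  [seq beta (coefs d) k | k <- iota 1 n.-1] ++
  [seq gamma (coefs d) k | k <- iota 1 n.-1] ++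
  [seq delta (coefs d) k | k <- iota 1 n.-1] ++
  [seq theta (coefs d) k | k <- iota 1 n.-1].
have size_part d : size (coefs_part d) = (5 * n.-1)%N.
  by rewrite !size_cat !size_map !size_iota !mulSn mul0n addn0.
have lt_i0n : (0 <= i < 0 + n)%N by [].
have avail_seg pre post f b :
    (forall d, input d = pre d ++ [seq f d j | j <- iota 0 n] ++ post d) ->
    (forall d, size (pre d) = b) -> avail [::] (fun d => f d i).
  by move=> inputE size_pre; apply: available_input inputE size_pre lt_i0n.
split.
  eapply (avail_seg coefs_part _ (fun d j => (mainP d 0)`_j)) => [d|]; last exact: size_part.
  by rewrite -!catA.
apply: (avail_seg (fun d => coefs_part d ++
                            [seq (mainP d 0)`_j | j <- iota 0 n])
                  (fun=> [::]) (fun d j => (auxP d 0)`_j)) => d.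
  by rewrite cats0 -!catA.
by rewrite size_cat size_part size_map size_iota.
Qed.

Lemma G_rec_within p k i : (k.+1 < n)%N -> preserves input [::] p ->
  avail p (fun d => (auxP d k)`_i) -> avail p (fun d => (mainP d k)`_i) ->
  computable_within input 3 p (fun d => (auxP d k.+1)`_i).
Proof.
move=> lt_kn ip ag aq; have [ca cb _ _ _] := @coefs_available k.+1 lt_kn.
apply: eq_within (within_add size_input_data
  (within_mul size_input_data (ip _ ca) ag)
  (within_mul size_input_data (ip _ cb) aq)) => d.
by rewrite (coef_G_rec (systemP d)).
Qed.

Lemma Q_rec_within p k i : (k.+1 < n)%N -> (i < n)%N ->
  preserves input [::] p ->
  avail p (fun d => (auxP d k)`_i) ->
  (forall j, (j < n)%N -> avail p (fun d => (mainP d k)`_j)) ->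
  computable_within input 5 p (fun d => (mainP d k.+1)`_i).
Proof.
move=> lt_kn lt_in ip ag aq.
have [_ _ cc cd ct] := @coefs_available k.+1 lt_kn.
have cgg := within_mul size_input_data (ip _ cc) ag.
have ctq := within_mul size_input_data (ip _ ct) (aq i lt_in).
case: i => [|i] in lt_in ag cgg ctq *.
  (* The constant coefficient receives nothing from the shift. *)
  apply: within_leq (eq_within _ (within_add size_input_data cgg ctq)) => // d.
  by rewrite (coef_Q_rec (systemP d)) // mulr0 add0r.
have cdq := within_mul size_input_data (ip _ cd) (aq i (ltnW lt_in)).
apply: eq_within (within_add size_input_data cgg
                   (within_add size_input_data cdq ctq)) => d.
by rewrite (coef_Q_rec (systemP d)).
Qed.

(** The next step reads G_k and Q_k alone, but the Q_j with j < k have to stay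
    available because they are part of the output. *)
Lemma basis_available k : (k < n)%N ->
  exists p, [/\ preserves input [::] p, (size p <= k * (8 * n))%N,
    forall i, (i < n)%N -> avail p (fun d => (auxP d k)`_i)
  & forall j i, (j <= k)%N -> (i < n)%N -> avail p (fun d => (mainP d j)`_i)].
Proof.
elim: k => [|k IHk] lt_kn.
  exists [::]; split=> // [i|j i]; first by case/initial_available.
  by rewrite leqn0 => /eqP-> /initial_available[].
have [p [ip le_p ag aq]] := IHk (ltnW lt_kn).
have cG i : (i < n)%N ->
    computable_within input 3 p (fun d => (auxP d k.+1)`_i).
  by move=> lt_in; apply: G_rec_within; [..|exact: ag|exact: aq].
have cQ i : (i < n)%N ->
    computable_within input 5 p (fun d => (mainP d k.+1)`_i).
  by move=> lt_in; apply: Q_rec_within; [..|exact: ag|move=> j; exact: aq].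
have [p1 [pp1 le_p1 ag1]] := within_all cG.
have [p2 [p1p2 le_p2 aq2]] :=
  within_all (fun i lt_in => within_preserves pp1 (cQ i lt_in)).
exists p2; split=> [v /ip/pp1/p1p2 //||i /ag1/p1p2 //|j i].
  have -> : (k.+1 * (8 * n) = k * (8 * n) + n * 3 + n * 5)%N.
    by rewrite -addnA -mulnDr (mulnC n) mulSn addnC.
  apply: leq_trans le_p2 _; rewrite leq_add2r.
  by apply: leq_trans le_p1 _; rewrite leq_add2r.
rewrite leq_eqVlt => /predU1P[->|lt_jk] lt_in; first exact: aq2.
exact/p1p2/pp1/aq.
Qed.

Lemma basis_computable :
  exists (p : slp) (out : 'I_n -> 'I_n -> nat), (size p <= 8 * n ^ 2)%N /\
  forall (r : recurrence_coefs F) (G Q : nat -> {poly F}),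
    quasiseparable_system n r G Q ->
    computes_mx p (input_data n r (Q 0) (G 0)) out (basis_mx n Q).
Proof.
have [n0|n_gt0] := posnP n.
  exists [::], (fun _ _ => 0%N); split=> // r G Q _.
  exists (input_data n r (Q 0) (G 0)) => // i.
  by have := ltn_ord i; rewrite [X in (_ < X)%N]n0 ltn0.
have lt_n1n : (n.-1 < n)%N by rewrite prednK.
have [p [_ le_p _ aQ]] := basis_available lt_n1n.
have /fin_all_exists[out outP] (ij : 'I_n * 'I_n) :
    exists a, forall d, exists2 mem, exec p (input d) = Some mem
      & onth mem a = Some (mainP d ij.2)`_ij.1.
  by apply: aQ => //; rewrite -ltnS prednK.
exists p, (fun i j => out (i, j)); split.
  apply: leq_trans le_p _; rewrite mulnCA leq_mul2l /=.
  by rewrite leq_mul2r leq_pred orbT.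
move=> r G Q sysGQ; pose d := System sysGQ.
have [mem pE _] := outP (Ordinal n_gt0, Ordinal n_gt0) d.
exists mem => // i j; have [mem' +] := outP (i, j) d.
by rewrite pE mxE => -[<-].
Qed.

End Computation.

Theorem lemma5p1 (R : realType) :
  (forall (n : nat) (r : recurrence_coefs R[i]) (G Q : nat -> {poly R[i]}),
     quasiseparable_system n r G Q ->
     let S_PQ := basis_mx n Q in
     let S_PG := basis_mx n G in
     let s k (lt_kn : (k.-1 < n)%N) := col (Ordinal lt_kn) S_PQ in
     let t k (lt_kn : (k.-1 < n)%N) := col (Ordinal lt_kn) S_PG in
     forall (k : nat) (lt_pkn : (k.-1 < n)%N) (lt_kn : (k.+1.-1 < n)%N),
       (0 < k)%N ->
       t k.+1 lt_kn = alpha r k *: t k lt_pkn + beta r k *: s k lt_pkn /\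
       s k.+1 lt_kn = gamma r k *: t k lt_pkn
         + (delta r k *: lower_shift R[i] n + (theta r k)%:M) *m s k lt_pkn)
  /\
  (exists c : nat, forall n : nat,
     exists (p : slp) (out : 'I_n -> 'I_n -> nat),
       (size p <= c * n ^ 2)%N /\
       forall (r : recurrence_coefs R[i]) (G Q : nat -> {poly R[i]}),
         quasiseparable_system n r G Q ->
         computes_mx p (input_data n r (Q 0%N) (G 0%N)) out (basis_mx n Q)).
Proof.
split=> [n r G Q sysGQ S_PQ S_PG s t [|k] // lt_pkn lt_kn _|].
  by split; [exact: col_G_rec | exact: col_Q_rec].
by exists 8%N => n; apply: basis_computable.
Qed.
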